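(* Let $X$ be a compact Hausdorff space, $\mathcal C=C(X)$ with the supremum norm, $\alpha\colon X\to X$ continuous, $\delta f=f\circ\alpha$, and $A$ a transfer operator for $(\mathcal C,\delta)$. Then for every $\varphi\in\mathcal C$, \[ \lambda(\varphi)=\max_{\mu\in M_\delta(\mathcal C)}\bigl(\tau(\mu)+\mu[\varphi]\bigr), \] in particular the maximum is attained.
   Context: A transfer operator for $(\mathcal C,\delta)$ is a positive linear operator $A\colon\mathcal C\to\mathcal C$ with $A((\delta f)g)=f\,Ag$ for all $f,g\in\mathcal C$. $A_\varphi f=A(e^\varphi f)$ and $\lambda(\varphi)=\lim_{n\to\infty}\frac1n\ln\|A_\varphi^n\mathbf 1\|$ ($\mathbf 1$ the constant function $1$). $M(\mathcal C)$ is the set of positive linear functionals $m$ on $\mathcal C$ with $m[\mathbf 1]=1$; $M_\delta(\mathcal C)$ those with additionally $\mu[\delta f]=\mu[f]$ for all $f$. A partition of unity is a finite set $D$ of nonnegative elements of $\mathcal C$ summing to $\mathbf 1$. For $\mu\in M_\delta(\mathcal C)$: $\tau_n(\mu,D)=\sup_{m\in M(\mathcal C)}\sum_{g\in D}\mu[g]\ln\frac{m[A^ng]}{\mu[g]}$, $\tau_n(\mu)=\inf_D\tau_n(\mu,D)$ over all partitions of unity, $\tau(\mu)=\inf_{n\in\mathbb N}\tau_n(\mu)/n$ (the $t$-entropy); summands with $\mu[g]=0$ are set to $0$, $\ln0=-\infty$, and if some $g\in D$ has $A^ng=0$ and $\mu[g]>0$ then $\tau(\mu)=-\infty$. *)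

(* Defs.v *)
From HB Require Import structures.
From mathcomp Require Import all_boot all_order all_algebra.
From mathcomp Require Import all_classical all_reals all_analysis.
Set Implicit Arguments. Unset Strict Implicit. Unset Printing Implicit Defensive.
Import Order.TTheory GRing.Theory Num.Theory.
Import numFieldTopology.Exports numFieldNormedType.Exports.
Local Open Scope classical_set_scope.
Local Open Scope ring_scope.

(* C(X) is represented by the predicate [continuous] on functions X -> R;
   operators and functionals are maps on all of X -> R, but every
   hypothesis and every quantity below only involves their values on
   continuous functions. *)

Section Defs.
Variables (R : realType) (X : topologicalType).

Definition cfun (f : X -> R) : Prop := continuous f.

Definition one_fun : X -> R := fun _ => 1.

Definition supnorm (f : X -> R) : R := sup [set `|f x| | x in [set: X]].

Definition eln (x : R) : \bar R := if x == 0 then -oo%E else (ln x)%:E.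

Definition delta (alpha : X -> X) (f : X -> R) : X -> R := f \o alpha.

Definition is_transfer_operator (alpha : X -> X) (A : (X -> R) -> (X -> R)) :
  Prop :=
  [/\ (forall f, cfun f -> cfun (A f)),
      (forall (a : R) f g, cfun f -> cfun g ->
          A (fun x => a * f x + g x) = (fun x => a * A f x + A g x)),
      (forall f, cfun f -> (forall x, 0 <= f x) -> forall x, 0 <= A f x) &
      (forall f g, cfun f -> cfun g ->
          A (fun x => delta alpha f x * g x) = (fun x => f x * A g x))].

Definition Aphi (A : (X -> R) -> (X -> R)) (phi : X -> R) (f : X -> R) :=
  A (fun x => expR (phi x) * f x).

Definition lambda_seq (A : (X -> R) -> (X -> R)) (phi : X -> R) (n : nat)
  : \bar R :=
  ((n.+1%:R)^-1)%:E * eln (supnorm (iter n.+1 (Aphi A phi) one_fun)).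

Definition is_state (m : (X -> R) -> R) : Prop :=
  [/\ (forall (a : R) f g, cfun f -> cfun g ->
          m (fun x => a * f x + g x) = a * m f + m g),
      (forall f, cfun f -> (forall x, 0 <= f x) -> 0 <= m f) &
      m one_fun = 1].

Definition is_inv_state (alpha : X -> X) (mu : (X -> R) -> R) : Prop :=
  is_state mu /\ forall f, cfun f -> mu (delta alpha f) = mu f.

(* partition of unity: a finite set {D i | i < k} (D injective) of
   nonnegative continuous functions summing to 1 *)
Definition is_pou (k : nat) (D : 'I_k -> X -> R) : Prop :=
  [/\ injective D, (forall i, cfun (D i)),
      (forall i x, 0 <= D i x) &
      (forall x, \sum_(i < k) D i x = 1)].

Definition tau_term (A : (X -> R) -> (X -> R)) (n : nat)
  (mu m : (X -> R) -> R) (g : X -> R) : \bar R :=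
  if mu g == 0 then 0%E else ((mu g)%:E * eln (m (iter n A g) / mu g))%E.

Definition tau_nD (A : (X -> R) -> (X -> R)) (n : nat) (mu : (X -> R) -> R)
  (k : nat) (D : 'I_k -> X -> R) : \bar R :=
  ereal_sup [set (\sum_(i < k) tau_term A n mu m (D i))%E | m in is_state].

Definition tau_n (A : (X -> R) -> (X -> R)) (n : nat) (mu : (X -> R) -> R)
  : \bar R :=
  ereal_inf [set t | exists k (D : 'I_k -> X -> R),
                       is_pou D /\ t = tau_nD A n mu D].

Definition tau (A : (X -> R) -> (X -> R)) (mu : (X -> R) -> R) : \bar R :=
  ereal_inf [set (((n.+1%:R)^-1)%:E * tau_n A n.+1 mu)%E | n in [set: nat]].

End Defs.

(* Main.v *)
(* Write S_n f for the Birkhoff sum of f along alpha.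

   Inequality.  If D is a partition of unity on whose members S_n phi is
   nearly constant, then m[A^n g] is nearly m[A_phi^n g] exp(-S_n phi) for g
   in D, and Jensen's inequality for ln gives
   tau_n(mu) + n mu[phi] <= ln |A_phi^n 1|.

   Attainment.  When lambda(phi) is finite there is an invariant mu with
   lambda(psi) >= lambda(phi) + mu[psi - phi] for all psi.  Given n and D, the
   first-order condition for a state m almost maximising the sum defining
   tau_n(mu, D) says that w = sum_g (mu[g] / m[A^n g]) g satisfies A^n w <= 1 up
   to a small error.  Then psi = (ln w) / n has lambda(psi) <= 0, so that
   mu[ln w] <= n (mu[phi] - lambda(phi)), while concavity of ln bounds mu[ln w]
   below by - tau_n(mu, D).  Hence tau(mu) >= lambda(phi) - mu[phi]. *)

Require Import Defs.
From HB Require Import structures.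
From mathcomp Require Import all_boot all_order all_algebra.
From mathcomp Require Import all_classical all_reals all_analysis.
From mathcomp Require Import ring lra.
Import Order.TTheory GRing.Theory Num.Theory.
Import numFieldTopology.Exports numFieldNormedType.Exports.
Local Open Scope classical_set_scope.
Local Open Scope ring_scope.
Set Implicit Arguments. Unset Strict Implicit. Unset Printing Implicit Defensive.

(** * Convexity inequalities *)

Section RealLemmas.
Variable R : realType.

Lemma ln_le_subr1 (y : R) : 0 < y -> ln y <= y - 1.
Proof.
move=> y0; have := @le_ln1Dx R (y - 1); rewrite subrKC; apply.
by rewrite ltrBrDr addNr.
Qed.

Lemma ln_ge_1Bdiv (y : R) : 0 < y -> 1 - y^-1 <= ln y.
Proof.
move=> y0; have yV0 : 0 < y^-1 by rewrite invr_gt0.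
by have := ln_le_subr1 yV0; rewrite lnV ?posrE //; lra.
Qed.

Lemma exists_pos_weight k (p : 'I_k -> R) : (forall i, 0 <= p i) ->
  \sum_i p i = 1 -> exists i, 0 < p i.
Proof.
move=> p0 p1; apply/not_existsP => np; have := oner_neq0 R.
rewrite -p1 big1 ?eqxx// => i _.
by apply/eqP; rewrite eq_le p0 leNgt andbT; apply/negP; exact: np.
Qed.

(* Valid also for vanishing weights: then [p i * ln (z i / p i) = 0]. *)
Lemma gibbs k (p z : 'I_k -> R) : (forall i, 0 <= p i) -> \sum_i p i = 1 ->
  (forall i, 0 <= z i) -> (forall i, 0 < p i -> 0 < z i) ->
  \sum_i p i * ln (z i / p i) <= ln (\sum_i z i).
Proof.
move=> p0 p1 z0 pz.
have [i pi0] := exists_pos_weight p0 p1.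
set Z := \sum_i z i.
have Z0 : 0 < Z.
  by rewrite /Z (bigD1 i) //= ltr_wpDr ?pz// sumr_ge0.
(* Termwise this is [ln y <= y - 1] at [y = z i / (p i * Z)]; the corrections [z i / Z - p i] sum to
   zero. *)
suff : \sum_i p i * ln (z i / p i) <= \sum_i (p i * ln Z + (z i / Z - p i)).
  rewrite big_split/= sumrB -mulr_suml p1 mul1r -mulr_suml mulfV ?gt_eqF//.
  by rewrite subrr addr0.
apply: ler_sum => j _.
have := p0 j; rewrite le_eqVlt => /predU1P[<-|pj0].
  by rewrite !mul0r add0r subr0 divr_ge0// ltW.
have zj0 := pz _ pj0.
have h : 0 < z j / p j / Z by rewrite !divr_gt0.
have := ln_le_subr1 h; rewrite ln_div ?posrE ?divr_gt0// => h2.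
have -> : z j / Z - p j = p j * (z j / p j / Z - 1).
  by field; rewrite !gt_eqF.
by rewrite -mulrDr ler_wpM2l//; lra.
Qed.

(** Jensen's inequality for [ln], obtained from [gibbs] with [z i = p i * c i]. *)
Lemma sum_ln_le k (p c : 'I_k -> R) : (forall i, 0 <= p i) ->
  \sum_i p i = 1 -> (forall i, 0 < c i) ->
  \sum_i p i * ln (c i) <= ln (\sum_i p i * c i).
Proof.
move=> p0 p1 c0; apply: le_trans (@gibbs _ p (fun i => p i * c i) p0 p1 _ _).
- apply: ler_sum => i _; have := p0 i; rewrite le_eqVlt => /predU1P[<-|pi0].
    by rewrite !mul0r.
  by rewrite mulrAC mulfV ?gt_eqF// mul1r.
- by move=> i; rewrite mulr_ge0 // ltW.
- by move=> i pi; rewrite mulr_gt0.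
Qed.

(** The tangent of the exponential at the mean [b] lies below the graph, and its linear terms cancel
    in the sum. *)
Lemma expR_mean n (a : 'I_n.+1 -> R) :
  expR (n.+1%:R^-1 * \sum_i a i) <= n.+1%:R^-1 * \sum_i expR (a i).
Proof.
set b := _ * \sum_i a i.
rewrite ler_pdivlMl// mulrC.
have -> : expR b * n.+1%:R = \sum_i (expR b * (1 + (a i - b))).
  rewrite -mulr_sumr big_split/= sumrB !sumr_const card_ord.
  congr (_ * _); rewrite -[b *+ _]mulr_natr /b.
  by rewrite mulrAC mulVf// mul1r subrr addr0.
apply: ler_sum => i _; rewrite -[a i in leRHS](subrKC b) expRD.
by rewrite ler_wpM2l ?expR_ge0// expR_ge1Dx.
Qed.

Lemma finite_pos_lb k (f : 'I_k -> R) : (forall i, 0 < f i) ->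
  exists2 b, 0 < b & forall i, b <= f i.
Proof.
move=> f0; exists (1 + \sum_i (f i)^-1)^-1.
  by rewrite invr_gt0 ltr_pwDl// sumr_ge0// => i _; rewrite invr_ge0 ltW.
move=> i; rewrite -[leRHS]invrK lef_pV2 ?posrE ?invr_gt0//; last first.
  by rewrite ltr_pwDl// sumr_ge0// => j _; rewrite invr_ge0 ltW.
rewrite (bigD1 i)//= addrCA lerDl addr_ge0// sumr_ge0// => j _.
by rewrite invr_ge0 ltW.
Qed.

(* First-order optimality for [v |-> \sum_i p i * ln (v i + e)] at a point whose
   value is close enough to the supremum; the shift [e] keeps the logarithms
   finite, so that no compactness of [K] is needed. *)
Lemma near_maximizer k (p : 'I_k -> R) (K : set ('I_k -> R)) (M e : R) :
  (forall i, 0 <= p i) -> \sum_i p i = 1 ->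
  K !=set0 -> (forall v, K v -> forall i, 0 <= v i <= M) ->
  (forall v w t, K v -> K w -> 0 < t < 1 ->
     K (fun i => (1 - t) * v i + t * w i)) ->
  0 < e <= 1 ->
  exists2 v, K v & forall w, K w -> \sum_i p i * (w i / (v i + e)) <= 1 + e.
Proof.
move=> p0 p1 [v0 Kv0] Kb Kc /andP[e0 e1].
pose G v := \sum_i p i * ln (v i + e).
have M0 : 0 <= M.
  have [i _] := exists_pos_weight p0 p1.
  by have /andP[] := Kb _ Kv0 i; exact: le_trans.
have GS : has_sup [set G v | v in K].
  split; first by exists (G v0), v0.
  exists (ln (M + e)) => _ [v Kv <-].
  rewrite -[leRHS]mul1r -p1 mulr_suml; apply: ler_sum => i _.
  rewrite ler_wpM2l// ler_ln ?posrE; have := Kb _ Kv i; lra.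
(* [B] bounds the ratios [(w i + e) / (v i + e)]. With the step [t], the second-order loss
   [2 * t * t * (B * B)] equals [t * e / 2], the same as the defect allowed for [v]. *)
pose B := (M + e) / e.
have B1 : 1 <= B by rewrite ler_pdivlMr//; lra.
have BB0 : 0 < B * B by rewrite mulr_gt0//; lra.
pose t := e / (4 * (B * B)).
have t0 : 0 < t by apply: divr_gt0 => //; apply: mulr_gt0.
have t1 : t <= 4^-1.
  rewrite /t ler_pdivrMr; last by apply: mulr_gt0; [lra|exact: BB0].
  have : 1 <= B * B by nra.
  lra.
have eta0 : 0 < t * e / 2 by rewrite divr_gt0// mulr_gt0.
have [_ [v Kv <-] Gv] := sup_adherent eta0 GS.
exists v => // w Kw.
pose r i := (w i + e) / (v i + e) - 1.
have ve i : 0 < v i + e by have := Kb _ Kv i; lra.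
have we i : 0 < w i + e by have := Kb _ Kw i; lra.
have rB i : - 1 <= r i <= B.
  rewrite /r; apply/andP; split.
    by have := divr_gt0 (we i) (ve i); lra.
  apply: (@le_trans _ _ ((w i + e) / (v i + e))); first by lra.
  rewrite ler_pdivrMr// /B mulrAC ler_pdivlMr//.
  have := Kb _ Kv i; have := Kb _ Kw i => /andP[? ?] /andP[? ?]; nra.
have Gt : G (fun i => (1 - t) * v i + t * w i) <= sup [set G v | v in K].
  apply: ub_le_sup; first by case: GS.
  by exists (fun i => (1 - t) * v i + t * w i) => //; apply: Kc => //; lra.
(* Expansion along the segment from [v] to [w]: [ln y >= 1 - y^-1] at [y = 1 + t * r i], where
   [y >= 1/2] controls the quadratic remainder. *)
have : \sum_i p i * (t * r i - 2 * t * t * (B * B)) <=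
    G (fun i => (1 - t) * v i + t * w i) - G v.
  rewrite /G -sumrB; apply: ler_sum => i _; rewrite -mulrBr ler_wpM2l//.
  have -> : (1 - t) * v i + t * w i + e = (v i + e) * (1 + t * r i).
    by rewrite /r; field; rewrite gt_eqF.
  have y0 : 2^-1 <= 1 + t * r i.
    have /andP[r1 _] := rB i.
    by have : 0 <= t * (r i + 1); [apply: mulr_ge0; lra|lra].
  rewrite lnM ?posrE//; last by lra.
  rewrite addrAC subrr add0r.
  have yp : 0 < 1 + t * r i by lra.
  apply: le_trans (ln_ge_1Bdiv yp).
  rewrite -subr_ge0; set y := 1 + t * r i in y0 yp *.
  have -> : 1 - y^-1 - (t * r i - 2 * t * t * (B * B)) =
     (2 * t * t * (B * B) * y - (y - 1) ^+ 2) / y.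
    have -> : t * r i = y - 1 by rewrite /y; lra.
    by field; rewrite gt_eqF.
  rewrite divr_ge0 ?(ltW yp)// subr_ge0.
  have -> : y - 1 = t * r i by rewrite /y; lra.
  have rr : r i * r i <= B * B.
    have /andP[r1 r2] := rB i; rewrite -subr_ge0.
    have -> : B * B - r i * r i = (B - r i) * (B + r i) by ring.
    by apply: mulr_ge0; lra.
  apply: (@le_trans _ _ (t * t * (B * B))).
    rewrite expr2 mulrACA ler_wpM2l//; first by rewrite mulr_ge0// ltW.
  have -> : 2 * t * t * (B * B) * y = (t * t * (B * B)) * (2 * y) by ring.
  by apply: ler_peMr; [rewrite -mulrA; do 2 (apply: mulr_ge0; first lra); lra|lra].
rewrite (eq_bigr (fun i => t * (p i * r i) - p i * (2 * t * t * (B * B))));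
  last by move=> i _; ring.
rewrite sumrB -mulr_suml p1 mul1r -mulr_sumr.
have -> : 2 * t * t * (B * B) = t * e / 2.
  by rewrite /t; field; rewrite gt_eqF //; lra.
move=> h.
have : t * (\sum_i p i * r i) <= t * e by lra.
rewrite ler_pM2l// => h2.
have : \sum_i p i * (w i / (v i + e)) <= \sum_i (p i * r i + p i).
  apply: ler_sum => i _.
  have -> : p i * r i + p i = p i * ((w i + e) / (v i + e)) by rewrite /r; ring.
  by rewrite ler_wpM2l// ler_wpM2r ?invr_ge0 ?(ltW (ve i))//; lra.
rewrite big_split/= p1; lra.
Qed.

End RealLemmas.

(** * Submultiplicative sequences *)

Section GrowthRate.
Variable R : realType.

(** Index [n] stands for the term [a n.+1], as in [lambda_seq]; a vanishing term gives [-oo]. *)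
Definition growth (a : nat -> R) (n : nat) : \bar R :=
  ((n.+1%:R)^-1)%:E * eln (a n.+1).

Lemma growth_le (a : nat -> R) n y : (forall n, 0 <= a n) ->
  (growth a n <= y%:E)%E = (a n.+1 <= expR (y * n.+1%:R)).
Proof.
move=> a0; rewrite /growth lee_pdivrMl// /eln; case: eqP => [->|/eqP an0].
  by rewrite leNye expR_ge0.
have ap : 0 < a n.+1 by rewrite lt_def an0 a0.
rewrite -EFinM lee_fin -[in LHS]ler_expR lnK ?posrE//.
by rewrite mulrC.
Qed.

Lemma growth_ge (a : nat -> R) n y : (forall n, 0 <= a n) ->
  (y%:E <= growth a n)%E -> expR (y * n.+1%:R) <= a n.+1.
Proof.
move=> a0; rewrite /growth lee_pdivlMl// /eln; case: eqP => // /eqP an0.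
have ap : 0 < a n.+1 by rewrite lt_def an0 a0.
by rewrite -EFinM lee_fin -[in X in X -> _]ler_expR lnK ?posrE// mulrC.
Qed.

(** Write [N = q * n.+1 + s]: the [q] full blocks give the exponential, and [C] absorbs the finitely
    many remainders [s]. *)
Lemma submult_growth (a : nat -> R) n y : (forall n, 0 <= a n) ->
  (forall m n, a (m + n)%N <= a m * a n) -> a n.+1 <= expR (y * n.+1%:R) ->
  exists2 C, 0 < C & forall N, a N <= C * expR (y * N%:R).
Proof.
move=> a0 aM an.
have aq q s : a (q * n.+1 + s)%N <= expR (y * (q * n.+1)%:R) * a s.
  elim: q => [|q IH]; first by rewrite mul0n mulr0 expR0 mul1r.
  rewrite mulSn -addnA (le_trans (aM _ _))// natrD mulrDr expRD -mulrA.
  by apply: ler_pM.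
pose C := 1 + \sum_(s < n.+1) a s * expR (- (y * s%:R)).
have C0 : 0 < C.
  by rewrite ltr_pwDl// sumr_ge0// => i _; rewrite mulr_ge0 ?expR_ge0.
exists C => // N; rewrite {1}(divn_eq N n.+1) (le_trans (aq _ _))//.
rewrite [in leRHS](divn_eq N n.+1) natrD mulrDr expRD mulrCA ler_wpM2l ?expR_ge0//.
rewrite -ler_pdivrMr ?expR_gt0// -expRN.
have sn : (N %% n.+1 < n.+1)%N by rewrite ltn_mod.
rewrite /C (bigD1 (Ordinal sn))//= addrCA lerDl addr_ge0//.
by rewrite sumr_ge0// => i _; rewrite mulr_ge0 ?expR_ge0.
Qed.

Lemma eventually_growth_le (a : nat -> R) C y e : (forall n, 0 <= a n) ->
  0 < C -> (forall N, a N <= C * expR (y * N%:R)) -> 0 < e ->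
  exists N0, forall N, (N0 <= N)%N -> (growth a N <= (y + e)%:E)%E.
Proof.
move=> a0 C0 aC e0; exists (Num.truncn (ln C / e)) => N leN.
rewrite growth_le// (le_trans (aC _))// mulrDl expRD mulrC.
rewrite ler_wpM2l ?expR_ge0// -ler_ln ?posrE ?expR_gt0// expRK.
rewrite -ler_pdivrMl// mulrC ltW// (lt_le_trans (truncnS_gt _))//.
by rewrite ler_nat ltnS.
Qed.

(** Fekete's lemma in multiplicative form: a real upper bound of one term bounds the upper limit,
    while the infimum lies below every term. *)
Lemma fekete (a : nat -> R) : (forall n, 0 <= a n) ->
  (forall m n, a (m + n)%N <= a m * a n) ->
  growth a @ \oo --> ereal_inf (range (growth a)).
Proof.
move=> a0 aM; apply: limn_esup_le_cvg; last first.
  by move=> n; apply: ereal_inf_lbound; exists n.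
apply: le_ereal_inf_tmp => _ [n _ <-].
have h (y : R) : (growth a n <= y%:E -> limn_esup (growth a) <= y%:E)%E.
  rewrite growth_le// => /(submult_growth a0 aM)[C C0 aC].
  apply/lee_addgt0Pr => e e0.
  have [N0 N0P] := eventually_growth_le a0 C0 aC e0.
  rewrite /limn_esup /limf_esup.
  apply: (@le_trans _ _ (ereal_sup [set growth a N | N in [set N | (N0 <= N)%N]])).
    apply: ereal_inf_lbound; exists [set N | (N0 <= N)%N] => //.
    by exists N0.
  by apply: ge_ereal_sup => _ [N /= leN <-]; rewrite -EFinD N0P.
case: (growth a n) h => [r||] h.
- exact: h.
- exact: leey.
(* A term equal to [-oo] makes every real number an upper bound, so the upper limit is [-oo] too. *)
- case: (limn_esup _) h => [r||] // h.
  + by have := h (r - 1)%R (leNye _); rewrite lee_fin lerBrDr gerDl ler10.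
  + by have := h 0%R (leNye _).
Qed.

End GrowthRate.

(** * States and transfer operators *)

Section ContinuousFunctions.
Variables (R : realType) (X : topologicalType).
Implicit Types (f g h : X -> R) (L : (X -> R) -> R).

Lemma cfun_cst (c : R) : @cfun R X (fun=> c).
Proof. by move=> x; exact: cvg_cst. Qed.

Lemma cfunD f g : cfun f -> cfun g -> cfun (fun x => f x + g x).
Proof. by move=> cf cg x; apply: (cvgD (cf x) (cg x)). Qed.

Lemma cfunM f g : cfun f -> cfun g -> cfun (fun x => f x * g x).
Proof. by move=> cf cg x; apply: (cvgM (cf x) (cg x)). Qed.

Lemma cfunB f g : cfun f -> cfun g -> cfun (fun x => f x - g x).
Proof. by move=> cf cg x; apply: (cvgB (cf x) (cg x)). Qed.

Lemma cfun_sum k (F : 'I_k -> X -> R) : (forall i, cfun (F i)) ->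
  cfun (fun x => \sum_i F i x).
Proof.
elim: k F => [|k IH] F cF.
  by under eq_fun do rewrite big_ord0; exact: cfun_cst.
under eq_fun do rewrite big_ord_recr /=.
by apply: cfunD => //; apply: IH.
Qed.

Lemma cfun_comp (b : X -> X) f : continuous b -> cfun f ->
  cfun (fun x => f (b x)).
Proof. by move=> cb cf x; apply: (continuous_comp (cb x) (cf _)). Qed.

Lemma cfun_norm f : cfun f -> cfun (fun x => `|f x|).
Proof. by move=> cf x; apply: cvg_norm; exact: cf. Qed.

Lemma cfun_expR f : cfun f -> cfun (fun x => expR (f x)).
Proof.
by move=> cf x; apply: (continuous_comp (cf x)); exact: continuous_expR.
Qed.

Lemma cfun_ln f : cfun f -> (forall x, 0 < f x) -> cfun (fun x => ln (f x)).
Proof.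
by move=> cf f0 x; apply: (continuous_comp (cf x)); exact: continuous_ln.
Qed.

(** States without the normalisation, so that [f |-> m (iter n A f)] is covered as well. *)
Definition posfun L : Prop :=
  (forall (a : R) f g, cfun f -> cfun g ->
     L (fun x => a * f x + g x) = a * L f + L g) /\
  (forall f, cfun f -> (forall x, 0 <= f x) -> 0 <= L f).

Lemma state_posfun m : is_state m -> posfun m. Proof. by case. Qed.

Section Posfun.
Variables (L : (X -> R) -> R) (Lpos : posfun L).

Lemma posfun0 : L (fun=> 0) = 0.
Proof.
have := Lpos.1 1 _ _ (@cfun_cst 0) (@cfun_cst 0).
by under eq_fun do rewrite mulr0 addr0; rewrite mul1r; lra.
Qed.

Lemma posfunD f g : cfun f -> cfun g -> L (fun x => f x + g x) = L f + L g.
Proof.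
move=> cf cg; rewrite -[L f]mul1r -Lpos.1//; congr L.
by apply/funext => x; rewrite mul1r.
Qed.

Lemma posfunZ a f : cfun f -> L (fun x => a * f x) = a * L f.
Proof.
move=> cf; rewrite -[RHS]addr0 -posfun0 -Lpos.1 //; last exact: cfun_cst.
by congr L; apply/funext => x; rewrite addr0.
Qed.

Lemma posfun_cst (c : R) : L (fun=> c) = c * L (@Defs.one_fun R X).
Proof.
rewrite -posfunZ; last exact: cfun_cst.
by congr L; apply/funext => x; rewrite mulr1.
Qed.

Lemma posfunB f g : cfun f -> cfun g -> L (fun x => f x - g x) = L f - L g.
Proof.
move=> cf cg; have -> : - L g = - 1 * L g by rewrite mulN1r.
rewrite addrC -Lpos.1//; congr L.
by apply/funext => x; rewrite mulN1r addrC.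
Qed.

Lemma posfun_sum k (F : 'I_k -> X -> R) : (forall i, cfun (F i)) ->
  L (fun x => \sum_i F i x) = \sum_i L (F i).
Proof.
elim: k F => [|k IH] F cF.
  by rewrite big_ord0 -[RHS]posfun0; congr L; apply/funext => x; rewrite big_ord0.
rewrite big_ord_recr/= -IH// -posfunD//; last by apply: cfun_sum => i.
by congr L; apply/funext => x; rewrite big_ord_recr.
Qed.

Lemma posfun_le f g : cfun f -> cfun g -> (forall x, f x <= g x) -> L f <= L g.
Proof.
move=> cf cg fg; rewrite -subr_ge0 -posfunB//; apply: Lpos.2.
  exact: cfunB.
by move=> x; rewrite subr_ge0.
Qed.

Lemma posfun_scale c : 0 <= c -> posfun (fun f => c * L f).
Proof.
move=> c0; split=> [a f g cf cg|f cf f0].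
  by rewrite Lpos.1// mulrDr mulrCA.
by rewrite mulr_ge0// Lpos.2.
Qed.

Lemma posfun_normalize : 0 < L (@Defs.one_fun R X) ->
  is_state (fun f => L f / L (@Defs.one_fun R X)).
Proof.
move=> L1; split=> [a f g cf cg|f cf f0|].
- by rewrite Lpos.1// mulrDl mulrA.
- by rewrite divr_ge0 ?(ltW L1)// Lpos.2.
- by rewrite mulfV// gt_eqF.
Qed.

End Posfun.

Lemma posfun_add L1 L2 : posfun L1 -> posfun L2 -> posfun (fun f => L1 f + L2 f).
Proof.
move=> [l1 p1] [l2 p2]; split=> [a f g cf cg|f cf f0].
  by rewrite l1// l2// mulrDr addrACA.
by rewrite addr_ge0 ?p1 ?p2.
Qed.

Lemma eval_state (x : X) : @is_state R X (fun f => f x).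
Proof. by split. Qed.

Lemma state_cst m c : @is_state R X m -> m (fun=> c) = c.
Proof.
by move=> ms; rewrite (posfun_cst (state_posfun ms)); case: ms => _ _ ->; rewrite mulr1.
Qed.

Lemma state_le m f c : is_state m -> cfun f -> (forall x, f x <= c) -> m f <= c.
Proof.
move=> ms cf fc; rewrite -[leRHS](state_cst _ ms).
by apply: posfun_le => //; [exact: state_posfun|exact: cfun_cst].
Qed.

Lemma state_ge m f c : is_state m -> cfun f -> (forall x, c <= f x) -> c <= m f.
Proof.
move=> ms cf fc; rewrite -[leLHS](state_cst _ ms).
by apply: posfun_le => //; [exact: state_posfun|exact: cfun_cst].
Qed.

Lemma state_convex m1 m2 t : is_state m1 -> is_state m2 -> 0 < t < 1 ->
  is_state (fun f => (1 - t) * m1 f + t * m2 f).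
Proof.
move=> s1 s2 /andP[t0 t1].
have [lin ge0] : posfun (fun f => (1 - t) * m1 f + t * m2 f).
  by apply: posfun_add; apply: posfun_scale; try exact: state_posfun; lra.
by split => //; case: s1 => _ _ ->; case: s2 => _ _ ->; lra.
Qed.

(** Apply [m] to the tangent of the exponential at [m h]. *)
Lemma state_jensen_expR m h : is_state m -> cfun h ->
  expR (m h) <= m (fun x => expR (h x)).
Proof.
move=> ms ch; set a := m h; have mp := state_posfun ms.
have <- : m (fun x => expR a * (h x + (1 - a))) = expR a.
  rewrite (posfunZ mp); last by apply: cfunD => //; exact: cfun_cst.
  rewrite (posfunD mp) ?state_cst//; last exact: cfun_cst.
  by rewrite addrCA subrr addr0 mulr1.
apply: (posfun_le mp) => [||x].
- by apply: cfunM; [exact: cfun_cst|apply: cfunD => //; exact: cfun_cst].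
- exact: cfun_expR.
- rewrite -[h x in leRHS](subrKC a) expRD ler_wpM2l ?expR_ge0//.
  by rewrite addrCA expR_ge1Dx.
Qed.

End ContinuousFunctions.

(** * Iterates of weighted transfer operators and Birkhoff sums *)

Section TransferOperator.
Variables (R : realType) (X : topologicalType).
Implicit Types (f g h phi : X -> R) (A : (X -> R) -> (X -> R)).
Implicit Types (alpha : X -> X).

Lemma continuous_iter alpha n : continuous alpha -> continuous (iter n alpha).
Proof.
move=> ca; elim: n => [|n IH] x; first exact: cvg_id.
exact: (continuous_comp (IH x) (ca _)).
Qed.

(** The identity for [n.+1] moves [f \o alpha] out of [iter n A] and then [f] out of [A]. Facts
    about one operator thus pass to its iterates. *)
Lemma transfer_iter alpha A n : continuous alpha ->
  is_transfer_operator alpha A ->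
  is_transfer_operator (iter n alpha) (iter n A).
Proof.
move=> ca [A1 A2 A3 A4]; elim: n => [|n [B1 B2 B3 B4]]; first by split.
split=> [f cf|a f g cf cg|f cf f0|f g cf cg] /=.
- exact/A1/B1.
- by rewrite B2// A2//; exact: B1.
- by apply: A3; [exact: B1|exact: B3].
- rewrite -A4 //; last exact: B1.
  by congr A; rewrite -B4 //; exact: cfun_comp.
Qed.

Lemma transfer_Aphi alpha A phi : cfun phi -> is_transfer_operator alpha A ->
  is_transfer_operator alpha (Aphi A phi).
Proof.
move=> cphi [A1 A2 A3 A4]; have ce := cfun_expR cphi.
split=> [f cf|a f g cf cg|f cf f0|f g cf cg].
- by apply: A1; exact: cfunM.
- rewrite /Aphi -A2; [|exact: cfunM..].
  by congr A; apply/funext => x; rewrite mulrDr mulrCA.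
- by apply: A3 => [|x]; [exact: cfunM|rewrite mulr_ge0 ?expR_ge0].
- rewrite /Aphi -A4//; last exact: cfunM.
  by congr A; apply/funext => x; rewrite mulrCA.
Qed.

Definition birkhoff alpha n f : X -> R :=
  fun x => \sum_(i < n) f (iter i alpha x).

Lemma cfun_birkhoff alpha n f : continuous alpha -> cfun f ->
  cfun (birkhoff alpha n f).
Proof.
move=> ca cf; apply: cfun_sum => i.
by apply: cfun_comp => //; exact: continuous_iter.
Qed.

(** The transfer identity brings the outer weight inside as [S_n phi \o alpha], which together with
    [phi] is [S_(n+1) phi]. *)
Lemma iter_Aphi alpha A phi n f : continuous alpha ->
  is_transfer_operator alpha A -> cfun phi -> cfun f ->
  iter n (Aphi A phi) f =
  iter n A (fun x => expR (birkhoff alpha n phi x) * f x).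
Proof.
move=> ca hA cphi; have [A1 A2 A3 A4] := hA.
elim: n f => [|n IH] f cf.
  rewrite /=; apply/funext => x.
  by rewrite /birkhoff big_ord0 expR0 mul1r.
rewrite iterSr IH //; last by apply: A1; apply: cfunM => //; exact: cfun_expR.
rewrite iterSr; congr (iter n A _).
rewrite -A4; last 2 first.
- by apply: cfun_expR; exact: cfun_birkhoff.
- by apply: cfunM => //; exact: cfun_expR.
congr A; apply/funext => x; rewrite /delta/= mulrA -expRD; congr (expR _ * _).
rewrite /birkhoff big_ord_recl /= addrC; congr (_ + _).
by apply: eq_bigr => i _; rewrite -iterSr.
Qed.

(** With [L] an evaluation at a point, the lemmas on positive functionals yield pointwise statements
    about [A]. *)
Lemma transfer_eval_posfun alpha A L : is_transfer_operator alpha A ->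
  posfun L -> posfun (fun f => L (A f)).
Proof.
move=> [A1 A2 A3 A4] [l p]; split=> [a f g cf cg|f cf f0].
  by rewrite A2// l//; exact: A1.
by apply: p; [exact: A1|exact: A3].
Qed.

Lemma transfer_le alpha A f g : is_transfer_operator alpha A ->
  cfun f -> cfun g -> (forall x, f x <= g x) -> forall x, A f x <= A g x.
Proof.
move=> hA cf cg fg x.
apply: (posfun_le (L := fun f => A f x)) => //.
exact: (transfer_eval_posfun hA (state_posfun (@eval_state R X x))).
Qed.

Lemma transferZ alpha A c f : is_transfer_operator alpha A -> cfun f ->
  A (fun x => c * f x) = (fun x => c * A f x).
Proof.
move=> hA cf; apply/funext => x.
apply: (posfunZ (L := fun f => A f x)) => //.
exact: (transfer_eval_posfun hA (state_posfun (@eval_state R X x))).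
Qed.

Lemma transfer_sum alpha A k (F : 'I_k -> X -> R) x :
  is_transfer_operator alpha A -> (forall i, cfun (F i)) ->
  A (fun x => \sum_i F i x) x = \sum_i A (F i) x.
Proof.
move=> hA cF.
apply: (posfun_sum (L := fun f => A f x)) => //.
exact: (transfer_eval_posfun hA (state_posfun (@eval_state R X x))).
Qed.

End TransferOperator.

(** * Supremum norms on a compact space *)

Section CompactSpace.
Variables (R : realType) (X : topologicalType).
Hypothesis hcompact : compact [set: X].
Hypothesis hne : [set: X] !=set0.
Implicit Types (f g h phi : X -> R) (A : (X -> R) -> (X -> R)).
Implicit Types (alpha : X -> X).

Lemma cfun_max f : cfun f -> exists x, forall y, f y <= f x.
Proof.
move=> cf; have [|x _ fx] := @compact_EVT_max X R f setT hne hcompact.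
  by apply: continuous_subspaceT => x; exact: cf.
by exists x => y; apply: fx; rewrite inE.
Qed.

Lemma supnorm_max f : cfun f -> exists x, supnorm f = `|f x|.
Proof.
move=> cf; have [x fx] := cfun_max (cfun_norm cf).
exists x; apply/le_anti/andP; split.
  by apply: ge_sup; [exists `|f x|, x|move=> _ [y _ <-]; exact: fx].
apply: ub_le_sup; last by exists x.
by exists `|f x| => _ [y _ <-]; exact: fx.
Qed.

Lemma le_supnorm f x : cfun f -> `|f x| <= supnorm f.
Proof.
move=> cf; have [y fy] := cfun_max (cfun_norm cf).
by apply: ub_le_sup; [exists `|f y| => _ [z _ <-]; exact: fy|exists x].
Qed.

Lemma supnorm_ge0 f : cfun f -> 0 <= supnorm f.
Proof. by move=> /supnorm_max[x ->]. Qed.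

(** For a positive operator this is the operator norm of [iter n A]. *)
Definition iter_norm A n := supnorm (iter n A (@Defs.one_fun R X)).

Section IterNorm.
Variables (alpha : X -> X) (A : (X -> R) -> (X -> R)).
Hypotheses (ca : continuous alpha) (hA : is_transfer_operator alpha A).

Lemma cfun_iter n f : cfun f -> cfun (iter n A f).
Proof. by have [h _ _ _] := transfer_iter n ca hA; exact: h. Qed.

Lemma iter_ge0 n f x : cfun f -> (forall x, 0 <= f x) -> 0 <= iter n A f x.
Proof. by have [_ _ h _] := transfer_iter n ca hA => cf f0; exact: h. Qed.

Lemma cfun_iter1 n : cfun (iter n A (@Defs.one_fun R X)).
Proof. by apply: cfun_iter; exact: cfun_cst. Qed.

Lemma iter1_ge0 n x : 0 <= iter n A (@Defs.one_fun R X) x.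
Proof. by apply: iter_ge0 => //; exact: cfun_cst. Qed.

Lemma iter1_le n x : iter n A (@Defs.one_fun R X) x <= iter_norm A n.
Proof. by apply: (le_trans (ler_norm _)); apply: le_supnorm; exact: cfun_iter1. Qed.

Lemma iter_norm_ge0 n : 0 <= iter_norm A n.
Proof. by apply: supnorm_ge0; exact: cfun_iter1. Qed.

Lemma iter_norm_max n :
  exists x, iter n A (@Defs.one_fun R X) x = iter_norm A n.
Proof.
have [x xE] := supnorm_max (@cfun_iter1 n).
by exists x; rewrite /iter_norm xE ger0_norm// iter1_ge0.
Qed.

Lemma iter_le_norm n f c x : cfun f -> (forall x, f x <= c) -> 0 <= c ->
  iter n A f x <= c * iter_norm A n.
Proof.
move=> cf fc c0; have hn := transfer_iter n ca hA.
apply: (@le_trans _ _ (iter n A (fun x => c * Defs.one_fun R x) x)).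
  apply: (transfer_le hn) => //.
    by apply: cfunM; exact: cfun_cst.
  by move=> y; rewrite mulr1.
by rewrite (transferZ _ hn)//; [rewrite ler_wpM2l ?iter1_le|exact: cfun_cst].
Qed.

(** [iter n A] of the constant one lies below the constant [iter_norm A n], to which [iter m A] is
    then applied. *)
Lemma iter_norm_submult m n :
  iter_norm A (m + n) <= iter_norm A m * iter_norm A n.
Proof.
have [x <-] := iter_norm_max (m + n); rewrite iterD mulrC.
apply: iter_le_norm; [exact: cfun_iter1|exact: iter1_le|exact: iter_norm_ge0].
Qed.

End IterNorm.

End CompactSpace.

(** The image ultrafilter has a cluster point in a compact segment, and an ultrafilter converges to
    its cluster points. *)
Lemma ultra_bounded_cvg (R : realType) (T : Type) (U : set_system T)
    (u : T -> R) (M : R) :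
  UltraFilter U -> (forall n, `|u n| <= M) -> cvg (u @ U).
Proof.
move=> UU uM; have UP : ProperFilter U by exact: ultra_proper.
have [] := @segment_compact R (- M) M (u @ U) _.
  apply: (@filterE T U _ (fun n => u n \in `[- M, M])) => n.
  by rewrite in_itv/= -ler_norml uM.
move=> p [_ pU]; apply/cvg_ex; exists p => B Bp.
have [//|UB] := in_ultra_setVsetC (u @^-1` B) UU.
by have [z [zB Bz]] := pU (~` B) B UB Bp.
Qed.

(** * Invariant states as limits of averages *)

Section InvariantStates.
Variables (R : realType) (X : topologicalType).
Hypothesis hcompact : compact [set: X].
Hypothesis hne : [set: X] !=set0.
Variables (alpha : X -> X) (ca : continuous alpha).
Implicit Types (f g h phi psi : X -> R).

(** Krylov-Bogolyubov averages of [nu n] along [alpha]. *)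
Definition averaged (nu : nat -> (X -> R) -> R) n f : R :=
  n.+1%:R^-1 * nu n (birkhoff alpha n.+1 f).

Lemma averaged_state (nu : nat -> (X -> R) -> R) n :
  is_state (nu n) -> is_state (averaged nu n).
Proof.
move=> ns; have np := state_posfun ns; rewrite /averaged.
split=> [a f g cf cg|f cf f0|].
- have -> : birkhoff alpha n.+1 (fun x => a * f x + g x) =
    (fun x => a * birkhoff alpha n.+1 f x + birkhoff alpha n.+1 g x).
    by apply/funext => x; rewrite /birkhoff big_split/= mulr_sumr.
  by rewrite np.1; [rewrite mulrDr mulrCA|exact: cfun_birkhoff..].
- rewrite mulr_ge0//; apply: np.2; first exact: cfun_birkhoff.
  by move=> x; rewrite sumr_ge0.
- have -> : birkhoff alpha n.+1 (@Defs.one_fun R X) = (fun=> n.+1%:R).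
    by apply/funext => x; rewrite /birkhoff sumr_const card_ord.
  by rewrite state_cst// mulVf.
Qed.

(** The two Birkhoff sums telescope to [f \o alpha^(n+1) - f]. *)
Lemma averaged_invariance (nu : nat -> (X -> R) -> R) n f :
  is_state (nu n) -> cfun f ->
  `|averaged nu n (delta alpha f) - averaged nu n f| <=
    n.+1%:R^-1 * (2 * supnorm f).
Proof.
move=> ns cf; have np := state_posfun ns; rewrite /averaged -mulrBr.
have cd : cfun (delta alpha f) by exact: cfun_comp.
rewrite -(posfunB np); [|exact: cfun_birkhoff..].
have -> : (fun x => birkhoff alpha n.+1 (delta alpha f) x -
    birkhoff alpha n.+1 f x) = (fun x => f (iter n.+1 alpha x) - f x).
  apply/funext => x; rewrite /birkhoff big_ord_recr/= big_ord_recl/=.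
  by rewrite /delta/=; ring.
rewrite normrM ger0_norm// ler_wpM2l// ler_norml.
have cfi : cfun (fun x => f (iter n.+1 alpha x) - f x).
  by apply: cfunB => //; apply: cfun_comp => //; exact: continuous_iter.
apply/andP; split; [apply: state_ge => //|apply: state_le => //] => x;
  have := le_supnorm hcompact hne x cf;
  have := le_supnorm hcompact hne (iter n.+1 alpha x) cf;
  rewrite !ler_norml => /andP[? ?] /andP[? ?]; lra.
Qed.

(* [mu] is the limit of the averages along an ultrafilter. *)
Lemma averaged_limit (nu : nat -> (X -> R) -> R) :
  (forall n, is_state (nu n)) ->
  exists2 mu, is_inv_state alpha mu &
    forall f c N, cfun f -> (forall n, (N <= n)%N -> averaged nu n f <= c) ->
      mu f <= c.
Proof.
(* One ultrafilter finer than [\oo] makes the averages of all continuous functions converge at once,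
   so the limit is linear. *)
move=> ns; have [U [UU finer]] := @ultraFilterLemma nat \oo _.
have UP : ProperFilter U by exact: ultra_proper.
have avs n := averaged_state (ns n).
have cvg_av f : cfun f -> cvg (averaged nu n f @[n --> U]).
  move=> cf; apply: (@ultra_bounded_cvg _ _ _ _ (supnorm f)) => n.
  rewrite ler_norml; apply/andP; split;
    [apply: state_ge => //|apply: state_le => //] => x;
    by have := le_supnorm hcompact hne x cf; rewrite ler_norml => /andP[].
pose mu f := lim (averaged nu n f @[n --> U]).
have mu_le f c : cfun f -> (\forall n \near U, averaged nu n f <= c) -> mu f <= c.
  by move=> cf fc; apply: limr_le => //; exact: cvg_av.
exists mu; last first.
  move=> f c N cf fc; apply: mu_le => //; apply: finer.
  by exists N.
have mus : is_state mu.
  split.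
  - move=> a f g cf cg; apply/cvg_lim => //.
    under eq_cvg do rewrite (state_posfun (avs _)).1//.
    apply: cvgD; last exact: cvg_av.
    by apply: cvgM; [exact: cvg_cst|exact: cvg_av].
  - move=> f cf f0; apply: limr_ge; first exact: cvg_av.
    by apply: filterE => n; case: (avs n) => _ p _; exact: p.
  - apply/cvg_lim => //.
    under eq_cvg do rewrite (state_cst _ (avs _)).
    exact: cvg_cst.
have mup := state_posfun mus; split => //.
(* The reverse inequality is this one for [-f]. *)
- suff mu_delta f : cfun f -> mu (delta alpha f) <= mu f.
    move=> f cf; apply/le_anti/andP; split; first exact: mu_delta.
    have cN : cfun (fun x => -1 * f x) by apply: cfunM => //; exact: cfun_cst.
    have cd : cfun (delta alpha f) by exact: cfun_comp.
    have := mu_delta _ cN.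
    have -> : delta alpha (fun x => -1 * f x) = (fun x => -1 * delta alpha f x).
      by [].
    by rewrite !(posfunZ mup)// !mulN1r lerN2.
  move=> cf; have cd : cfun (delta alpha f) by exact: cfun_comp.
  rewrite -subr_le0 -(posfunB mup)//; apply/ler_addgt0Pr => e e0.
  rewrite add0r; apply: mu_le; first exact: cfunB.
  apply: finer; exists (Num.truncn (2 * supnorm f / e)) => // n /= leN.
  rewrite (posfunB (state_posfun (avs n)))//.
  rewrite (le_trans (ler_norm _))// (le_trans (averaged_invariance (ns n) cf))//.
  rewrite ler_pdivrMl// -ler_pdivrMr// ltW// (lt_le_trans (truncnS_gt _))//.
  by rewrite ler_nat ltnS.
Qed.

End InvariantStates.

(** * Fine partitions of unity *)

Section FinePartitions.
Variable R : realType.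

(** Truncation of [t] to the interval from 0 to 1, written with absolute values so that continuity
    is immediate. *)
Definition ramp (t : R) : R := (`|t| - `|t - 1| + 1) / 2.

Lemma ramp_le0 t : t <= 0 -> ramp t = 0.
Proof. by move=> t0; rewrite /ramp ler0_norm// ler0_norm; lra. Qed.

Lemma ramp_ge1 t : 1 <= t -> ramp t = 1.
Proof. by move=> t1; rewrite /ramp !ger0_norm; lra. Qed.

Lemma ramp_itv t : 0 <= t <= 1 -> ramp t = t.
Proof. by move=> t1; rewrite /ramp ger0_norm ?ler0_norm; lra. Qed.

Lemma ramp_mono s t : s <= t -> ramp s <= ramp t.
Proof.
move=> st; have [s0|s0] := leP s 0; have [t0|t0] := leP t 0;
  have [s1|s1] := leP s 1; have [t1|t1] := leP t 1;
  rewrite ?(ramp_le0 s0) ?(ramp_le0 t0) ?(ramp_ge1 (ltW s1)) ?(ramp_ge1 (ltW t1))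
    ?(@ramp_itv t) ?(@ramp_itv s); lra.
Qed.

Variable X : topologicalType.
Hypothesis hcompact : compact [set: X].
Hypothesis hne : [set: X] !=set0.

(** Injectivity is left to [fine_pou]: the members built from ramps may coincide, for instance when
    several vanish. *)
Definition fine_family (h : X -> R) (e : R) k (D : 'I_k -> X -> R)
    (c : 'I_k -> R) : Prop :=
  [/\ (forall i, cfun (D i)), (forall i x, 0 <= D i x),
      (forall x, \sum_i D i x = 1) &
      (forall i x, 0 < D i x -> `|h x - c i| <= e)].

(** With [u = (h + C) / e], consecutive ramps differ by a tent supported where [|u - j| <= 1], and
    the tents telescope to 1. *)
Lemma fine_family_ramps (h : X -> R) e : cfun h -> 0 < e ->
  exists k (D : 'I_k -> X -> R) c, fine_family h e D c.
Proof.
move=> ch e0; set C := supnorm h.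
have hC x : - C <= h x <= C by rewrite -ler_norml le_supnorm.
(* Since [u <= 2 * C / e], the last ramp [s K] vanishes identically. *)
pose K := (Num.truncn (2 * C / e)).+2.
pose u x := (h x + C) / e.
pose s (j : nat) x := ramp (u x + 1 - j%:R).
have hu x : h x = u x * e - C by rewrite /u divfK ?gt_eqF// addrK.
exists K, (fun j x => s j x - s j.+1 x), (fun j => j%:R * e - C); split.
- move=> i; have cs j : cfun (s j).
    have cc (c : R) := @cfun_cst R X c.
    have cu : cfun (fun x => u x + 1 - j%:R).
      by apply: cfunB => //; apply: cfunD => //; apply: cfunM => //; exact: cfunD.
    apply: cfunM => //; apply: cfunD => //; apply: cfunB; apply: cfun_norm => //.
    exact: cfunB.
  exact: cfunB.
- by move=> i x; rewrite subr_ge0 ramp_mono// lerB// ler_nat.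
- move=> x; rewrite -(big_mkord xpredT (fun j => s j x - s j.+1 x)).
  under eq_bigr do rewrite -opprB.
  rewrite sumrN telescope_sumr// opprB /s subr0 ramp_ge1; last first.
    by rewrite lerDr divr_ge0 ?(ltW e0)//; have := hC x; lra.
  rewrite ramp_le0 ?subr0// subr_le0 /K -natr1 lerD2r.
  apply: (@le_trans _ _ (2 * C / e)); last by rewrite ltW ?truncnS_gt.
  by rewrite /u ler_wpM2r ?invr_ge0 ?(ltW e0)//; have := hC x; lra.
- move=> j x Dj.
  have h1 : 0 < u x + 1 - j%:R.
    rewrite ltNge; apply/negP => le0; move: Dj.
    rewrite /s (ramp_le0 le0) ramp_le0 ?subrr ?ltxx//.
    by rewrite (le_trans _ le0)// lerB// ler_nat.
  have h2 : u x + 1 - j.+1%:R < 1.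
    rewrite ltNge; apply/negP => le1; move: Dj.
    rewrite /s (ramp_ge1 le1) ramp_ge1 ?subrr ?ltxx//.
    by rewrite (le_trans le1)// lerB// ler_nat.
  move: h2; rewrite -natr1 hu => h2.
  have -> : u x * e - C - (j%:R * e - C) = (u x - j%:R) * e by ring.
  rewrite normrM (gtr0_norm e0) ler_piMl ?(ltW e0)//.
  by rewrite ler_norml; apply/andP; split; lra.
Qed.

(* A family of least cardinality is injective: two equal members could be merged. *)
Lemma fine_pou (h : X -> R) e : cfun h -> 0 < e ->
  exists k (D : 'I_k -> X -> R) c, is_pou D /\ fine_family h e D c.
Proof.
move=> ch e0.
have ex : exists k, `[< exists (D : 'I_k -> X -> R) c, fine_family h e D c >].
  by have [k Dc] := fine_family_ramps ch e0; exists k; apply/asboolP.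
case: (ex_minnP ex) => k /asboolP[D [c Dc]] kmin.
exists k, D, c; split => //; have [Dcont D0 D1 Dfine] := Dc; split => //.
move=> i j Dij; apply/eqP/negPn/negP => ij.
case: k D c Dc kmin Dcont D0 D1 Dfine i j Dij ij => [|k] D c Dc kmin Dcont D0 D1
  Dfine i j Dij ij; first by case: i {Dij ij}.
suff /asboolP/kmin : exists (D : 'I_k -> X -> R) c, fine_family h e D c.
  by rewrite ltnn.
(* Member [j] is dropped and added to its equal [i]; the sum has the support of [D i], so the label
   [c i] still fits. *)
pose D' (t : 'I_k) x := D (lift j t) x + (lift j t == i)%:R * D j x.
exists D', (fun t => c (lift j t)); split.
- move=> t; apply: cfunD => //; apply: cfunM => //; exact: cfun_cst.
- by move=> t x; rewrite addr_ge0// mulr_ge0.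
- move=> x; rewrite big_split/= -mulr_suml -[RHS](D1 x) [RHS](bigD1_ord j)//= addrC.
  congr (_ + _); rewrite -[RHS]mul1r; congr (_ * _).
  case: (unliftP j i) ij => [t ->|->]; last by rewrite eqxx.
  move=> _; rewrite (bigD1 t)//= eqxx [X in _ + X]big1 ?addr0// => t' t't.
  by rewrite (inj_eq lift_inj) (negbTE t't).
- move=> t x D't; apply: Dfine; move: D't; rewrite /D'.
  case: eqP => [->|_]; last by rewrite mul0r addr0.
  by rewrite mul1r Dij; lra.
Qed.

End FinePartitions.

(** * The variational inequality and equilibrium states *)

Section UpperBound.
Variables (R : realType) (X : topologicalType).
Hypothesis hcompact : compact [set: X].
Hypothesis hne : [set: X] !=set0.
Variables (alpha : X -> X) (A : (X -> R) -> (X -> R)).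
Hypotheses (ca : continuous alpha) (hA : is_transfer_operator alpha A).
Implicit Types (f g h phi psi : X -> R) (mu m : (X -> R) -> R).

Lemma inv_state_birkhoff mu n f : is_inv_state alpha mu -> cfun f ->
  mu (birkhoff alpha n f) = n%:R * mu f.
Proof.
move=> [mus inv] cf; have mup := state_posfun mus.
rewrite (posfun_sum mup); last first.
  by move=> i; apply: cfun_comp => //; exact: continuous_iter.
rewrite (eq_bigr (fun=> mu f)) ?sumr_const ?card_ord ?mulr_natl// => i _.
elim: (i : nat) => [|j IH] //.
rewrite -[RHS]IH -[RHS]inv; last by apply: cfun_comp => //; exact: continuous_iter.
by congr mu; apply/funext => x; rewrite /delta/= -iterSr.
Qed.

Lemma state_pou_weights mu k (D : 'I_k -> X -> R) : is_state mu -> is_pou D ->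
  (forall i, 0 <= mu (D i)) /\ \sum_i mu (D i) = 1.
Proof.
move=> mus [_ cD D0 D1]; have mup := state_posfun mus.
split; first by move=> i; exact: mup.2.
rewrite -(posfun_sum mup)//; under eq_fun do rewrite D1.
exact: state_cst.
Qed.

Lemma tau_term_fin n mu m g : 0 <= mu g -> 0 <= m (iter n A g) ->
  (mu g != 0 -> m (iter n A g) != 0) ->
  tau_term A n mu m g = (mu g * ln (m (iter n A g) / mu g))%:E.
Proof.
move=> mu0 m0 h; rewrite /tau_term; case: ifPn => [/eqP ->|gn0].
  by rewrite mul0r.
rewrite /eln ifF// mulf_eq0 invr_eq0 (negbTE gn0) orbF.
exact/negbTE/h.
Qed.

Lemma state_iter_posfun n m : is_state m -> posfun (fun f => m (iter n A f)).
Proof.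
by move=> /state_posfun; apply: transfer_eval_posfun; exact: transfer_iter.
Qed.

Lemma tau_sum_le phi n mu m k (D : 'I_k -> X -> R) c e : cfun phi ->
  is_inv_state alpha mu -> is_state m -> is_pou D ->
  fine_family (birkhoff alpha n phi) e D c ->
  (\sum_i tau_term A n mu m (D i) <=
    eln (iter_norm (Aphi A phi) n) + (2 * e - n%:R * mu phi)%:E)%E.
Proof.
move=> cphi muinv ms pouD [cD D0 D1 fineD].
have [mus _] := muinv; have mup := state_posfun mus.
have [p0 p1] := state_pou_weights mus pouD.
set S := birkhoff alpha n phi; have cS : cfun S by exact: cfun_birkhoff.
pose L f := m (iter n A f); have Lp : posfun L by exact: state_iter_posfun.
have v0 i : 0 <= L (D i) by apply: Lp.2.
(* A member with positive weight on which [m (iter n A _)] vanishes makes the whole sum [-oo]. *)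
have [[i [mui vi]]|nz] :=
    pselect (exists i, mu (D i) != 0 /\ L (D i) = 0).
  rewrite [leLHS](_ : _ = -oo%E) ?leNye//.
  apply/esum_eqNyP; exists i; split => // => //.
  rewrite /tau_term (negbTE mui) -/(L (D i)) vi mul0r /eln eqxx gt0_muleNy// lte_fin.
  by rewrite lt_def mui p0.
have vn0 i : mu (D i) != 0 -> L (D i) != 0.
  by move=> mui; apply/eqP => vi; apply: nz; exists i.
have vp i : 0 < mu (D i) -> 0 < L (D i).
  by move=> mui; rewrite lt_def v0 vn0// gt_eqF.
rewrite (eq_bigr (fun i => (mu (D i) * ln (L (D i) / mu (D i)))%:E)); last first.
  by move=> i _; apply: tau_term_fin; [exact: p0|exact: v0|exact: vn0].
rewrite sumEFin.
(* On the support of [D i] the factor [expR (c i - e)] is at most [expR (S x)], so the [z i] add up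
   to at most [m] of [A_phi^n 1]. *)
pose z i := expR (c i - e) * L (D i).
have z0 i : 0 <= z i by rewrite mulr_ge0 ?expR_ge0.
have zp i : 0 < mu (D i) -> 0 < z i by move=> ?; rewrite mulr_gt0 ?expR_gt0 ?vp.
have ceS : cfun (fun x => expR (S x)) by exact: cfun_expR.
have sumz : \sum_i z i <= iter_norm (Aphi A phi) n.
  apply: (@le_trans _ _ (L (fun x => \sum_i (expR (S x) * D i x)))).
    rewrite (posfun_sum Lp); last by move=> i; exact: cfunM.
    apply: ler_sum => i _; rewrite /z -(posfunZ Lp)//.
    apply: (posfun_le Lp) => [||x].
    - by apply: cfunM => //; exact: cfun_cst.
    - exact: cfunM.
    have := D0 i x; rewrite le_eqVlt => /predU1P[<-|Dx]; first by rewrite !mulr0.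
    rewrite ler_wpM2r// ler_expR; have := fineD i x Dx; rewrite ler_norml -/S; lra.
  rewrite /L.
  have -> : (fun x => \sum_i expR (S x) * D i x) =
      (fun x => expR (S x) * Defs.one_fun R x).
    by apply/funext => x; rewrite -mulr_sumr D1.
  have c1 : cfun (@Defs.one_fun R X) by exact: cfun_cst.
  rewrite -iter_Aphi//; have hB := transfer_Aphi cphi hA.
  apply: state_le => //; first exact: (cfun_iter1 ca hB).
  by move=> x; exact: (iter1_le hcompact hne ca hB).
have [i0 pi0] := exists_pos_weight p0 p1.
have sz0 : 0 < \sum_i z i.
  by rewrite (bigD1 i0)//= ltr_wpDr ?zp// sumr_ge0.
have a0 : 0 < iter_norm (Aphi A phi) n by exact: lt_le_trans sumz.
rewrite /eln gt_eqF// -EFinD lee_fin.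
have G := gibbs p0 p1 z0 zp.
have lnz : ln (\sum_i z i) <= ln (iter_norm (Aphi A phi) n).
  by rewrite ler_ln ?posrE.
have muS : n%:R * mu phi <= \sum_i (c i + e) * mu (D i).
  rewrite -(inv_state_birkhoff n muinv cphi) -/S.
  have -> : S = (fun x => \sum_i S x * D i x).
    by apply/funext => x; rewrite -mulr_sumr D1 mulr1.
  rewrite (posfun_sum mup); last by move=> i; exact: cfunM.
  apply: ler_sum => i _; rewrite -(posfunZ mup)//.
  apply: (posfun_le mup) => [||x].
  - exact: cfunM.
  - by apply: cfunM => //; exact: cfun_cst.
  have := D0 i x; rewrite le_eqVlt => /predU1P[<-|Dx]; first by rewrite !mulr0.
  rewrite ler_wpM2r//; have := fineD i x Dx; rewrite ler_norml -/S; lra.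
(* The exponent [c i - e] is split as [(c i + e) - 2 * e] to match [muS]. *)
have zE : \sum_i mu (D i) * ln (z i / mu (D i)) =
  \sum_i mu (D i) * ln (L (D i) / mu (D i)) +
  (\sum_i (c i + e) * mu (D i) - 2 * e).
  have -> : 2 * e = \sum_i mu (D i) * (2 * e) by rewrite -mulr_suml p1 mul1r.
  rewrite -sumrB -big_split/=; apply: eq_bigr => i _.
  have := p0 i; rewrite le_eqVlt => /predU1P[<-|mui].
    by rewrite !mul0r mulr0 subr0 addr0.
  rewrite /z -mulrA lnM ?posrE ?expR_gt0 ?divr_gt0 ?vp// expRK; ring.
by rewrite zE in G; lra.
Qed.

Lemma tau_n_le phi n mu : cfun phi -> is_inv_state alpha mu ->
  (tau_n A n mu <=
    eln (iter_norm (Aphi A phi) n) + (- (n%:R * mu phi))%:E)%E.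
Proof.
move=> cphi muinv; apply/lee_addgt0Pr => e e0.
have e20 : 0 < e / 2 by rewrite divr_gt0.
have [k [D [c [pouD fineD]]]] :=
  fine_pou hcompact hne (cfun_birkhoff (n := n) ca cphi) e20.
apply: (@le_trans _ _ (tau_nD A n mu D)).
  by apply: ereal_inf_lbound; exists k, D.
apply: ge_ereal_sup => _ [m ms <-].
apply: le_trans (tau_sum_le cphi muinv ms pouD fineD) _.
rewrite -addeA -EFinD leeD2l// lee_fin; lra.
Qed.

Lemma tau_le_growth phi n mu : cfun phi -> is_inv_state alpha mu ->
  (tau A mu + (mu phi)%:E <= growth (iter_norm (Aphi A phi)) n)%E.
Proof.
move=> cphi muinv; rewrite -leeBrDr// /growth.
apply: (@le_trans _ _ ((n.+1%:R^-1)%:E * tau_n A n.+1 mu)%E).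
  by apply: ereal_inf_lbound; exists n.
rewrite lee_pdivrMl// muleBr// -?EFinM; last by rewrite fin_num_adde_defl.
rewrite muleA -EFinM mulfV// mul1e.
by have := tau_n_le n.+1 cphi muinv; rewrite EFinN.
Qed.

(* [mu] is a subgradient at [phi] of the convex function
   [psi |-> lambda(psi)]: it is a limit of the averaged derivatives of
   [psi |-> 1/n ln (A_psi^n 1)(x_n)], where [A_phi^n 1] is maximal at [x_n]. *)
Lemma equilibrium_state phi l : cfun phi ->
  (forall n, expR (l * n.+1%:R) <= iter_norm (Aphi A phi) n.+1) ->
  exists2 mu, is_inv_state alpha mu &
    forall psi y n, cfun psi ->
      iter_norm (Aphi A psi) n.+1 <= expR (y * n.+1%:R) ->
      mu psi - mu phi <= y - l.
Proof.
move=> cphi hl; have hB := transfer_Aphi cphi hA.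
have /choice[x xmax] : forall n, exists x,
    iter n.+1 (Aphi A phi) (@Defs.one_fun R X) x = iter_norm (Aphi A phi) n.+1.
  by move=> n; exact: (iter_norm_max hcompact hne ca hB).
pose L n f := iter n.+1 (Aphi A phi) f (x n).
have Lp n : posfun (L n).
  apply: (transfer_eval_posfun (L := fun f => f (x n))
    (transfer_iter n.+1 ca hB)).
  exact: (state_posfun (@eval_state R X (x n))).
have Z0 n : 0 < iter_norm (Aphi A phi) n.+1.
  exact: lt_le_trans (expR_gt0 _) (hl n).
have L1 n : L n (@Defs.one_fun R X) = iter_norm (Aphi A phi) n.+1 by exact: xmax.
pose nu n f := L n f / L n (@Defs.one_fun R X).
have nus n : is_state (nu n).
  by apply: posfun_normalize; [exact: Lp|rewrite L1].
have [mu muinv mu_le] := averaged_limit hcompact hne ca nus.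
exists mu => // psi y n cpsi hn; have [mus _] := muinv.
have mup := state_posfun mus.
have hC := transfer_Aphi cpsi hA.
have [C C0 aC] := submult_growth (iter_norm_ge0 hcompact hne ca hC)
  (iter_norm_submult hcompact hne ca hC) hn.
(* Multiplying by [expR (S_N h)] turns [A_phi^N] into [A_psi^N], so Jensen's inequality for [nu N]
   compares the two norms. *)
pose h t := psi t - phi t; have ch : cfun h by exact: cfunB.
rewrite -(posfunB mup)//; apply/ler_addgt0Pr => e e0.
apply: (mu_le h _ (Num.truncn (ln C / e))) => // N leN.
rewrite /averaged ler_pdivrMl//.
have cS : cfun (birkhoff alpha N.+1 h) by exact: cfun_birkhoff.
have := state_jensen_expR (nus N) cS; rewrite {2}/nu L1.
have -> : L N (fun t => expR (birkhoff alpha N.+1 h t)) =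
    iter N.+1 (Aphi A psi) (@Defs.one_fun R X) (x N).
  have c1 : cfun (@Defs.one_fun R X) by exact: cfun_cst.
  rewrite /L !(iter_Aphi _ ca hA)//; last exact: cfun_expR.
  congr (iter N.+1 A _ _); apply/funext => t; rewrite mulr1 -expRD.
  congr expR; rewrite /birkhoff -big_split/=; apply: eq_bigr => i _.
  by rewrite /h addrC subrK.
rewrite ler_pdivlMr// => hN.
(* Hence [nu N (S h) <= (y - l) * N.+1 + ln C], and [ln C] disappears after division by [N.+1]. *)
have : expR (nu N (birkhoff alpha N.+1 h)) * expR (l * N.+1%:R) <=
    C * expR (y * N.+1%:R).
  apply: le_trans (aC N.+1).
  apply: le_trans (iter1_le hcompact hne ca hC N.+1 (x N)).
  by apply: le_trans hN; rewrite ler_wpM2l ?expR_ge0.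
rewrite -[X in _ <= X * _](@lnK _ C) ?posrE// -!expRD ler_expR => hN2.
have : ln C <= N.+1%:R * e.
  rewrite -ler_pdivrMr// ltW// (lt_le_trans (truncnS_gt _))//.
  by rewrite ler_nat ltnS.
lra.
Qed.

End UpperBound.

(** * The lower bound for the t-entropy *)

Section LowerBound.
Variables (R : realType) (X : topologicalType).
Hypothesis hcompact : compact [set: X].
Hypothesis hne : [set: X] !=set0.
Variables (alpha : X -> X) (A : (X -> R) -> (X -> R)).
Hypotheses (ca : continuous alpha) (hA : is_transfer_operator alpha A).
Implicit Types (f g h phi psi w : X -> R) (mu m : (X -> R) -> R).

Lemma birkhoffD p q f x :
  birkhoff alpha (p + q) f x =
  birkhoff alpha p f x + birkhoff alpha q f (iter p alpha x).
Proof.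
rewrite /birkhoff big_split_ord/=; congr (_ + _).
by apply: eq_bigr => i _; rewrite addnC iterD.
Qed.

(** Times are grouped by residue modulo [n]: the orbit splits into [n] interleaved orbits of
    [iter n alpha]. *)
Lemma birkhoffM k n f x : birkhoff alpha (k * n) f x =
  \sum_(r < n) birkhoff (iter n alpha) k f (iter r alpha x).
Proof.
elim: k x => [|k IH] x.
  by rewrite mul0n /birkhoff big_ord0 big1// => r _; rewrite big_ord0.
rewrite mulSn birkhoffD IH {1}/birkhoff -big_split/=; apply: eq_bigr => r _.
rewrite /birkhoff big_ord_recl/=; congr (_ + _); apply: eq_bigr => i _.
by rewrite -iterD (addnC (r : nat)) iterD -iterSr.
Qed.

(* With [N = n.+1], the exponential of the Birkhoff sum of [ln w / N] of length
   [k N] is at most the mean over [r < N] of [Q k o alpha^r], where [Q k] is the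
   product of [w o alpha^(N i)] over [i < k]; and [A^(k N) (Q k) <= 1]. *)
Lemma log_average_growth n w (y : R) : cfun w -> (forall x, 0 < w x) ->
  (forall x, iter n.+1 A w x <= 1) -> 0 < y ->
  exists q, iter_norm (Aphi A (fun x => n.+1%:R^-1 * ln (w x))) q.+1 <=
    expR (y * q.+1%:R).
Proof.
move=> cw w0 Aw y0; set psi := fun x : X => _.
pose lw x := ln (w x); have clw : cfun lw by exact: cfun_ln.
have cpsi : cfun psi by apply: cfunM => //; exact: cfun_cst.
have hP := transfer_Aphi cpsi hA.
have hN := transfer_iter n.+1 ca hA.
have caN : continuous (iter n.+1 alpha) by exact: continuous_iter.
have hB := transfer_Aphi clw hN.
have c1 : cfun (@Defs.one_fun R X) by exact: cfun_cst.
have expw x : expR (lw x) = w x by rewrite lnK// posrE.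
pose Q k x := expR (birkhoff (iter n.+1 alpha) k lw x).
have cQ k : cfun (Q k) by apply: cfun_expR; exact: cfun_birkhoff.
have Q0 k x : 0 <= Q k x by exact: expR_ge0.
have AQ k x : iter (k * n.+1) A (Q k) x <= 1.
  have -> : iter (k * n.+1) A (Q k) =
      iter k (Aphi (iter n.+1 A) lw) (@Defs.one_fun R X).
    rewrite (iter_Aphi k caN hN)// iterM; congr (iter _ _ _).
    by apply/funext => z; rewrite mulr1.
  elim: k x => [|k IH] x //=.
  have -> : 1 = Defs.one_fun R x by [].
  apply: (@le_trans _ _ (Aphi (iter n.+1 A) lw (@Defs.one_fun R X) x)).
    apply: (transfer_le hB) => //; exact: (cfun_iter1 caN hB).
  apply: le_trans (Aw x); rewrite /Aphi le_eqVlt; apply/orP; left; apply/eqP.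
  by congr (iter _ _ _ _); apply/funext => z; rewrite mulr1 expw.
pose W := supnorm w; pose a := iter_norm A.
have W0 : 0 <= W by exact: supnorm_ge0.
have a0 r : 0 <= a r by exact: (iter_norm_ge0 hcompact hne ca hA).
(* One factor is sacrificed because, once [alpha^r] is removed, only [k] full blocks of iterates are
   sure to remain. *)
have QW k x : Q k.+1 x <= W * Q k x.
  rewrite /Q {1}/birkhoff big_ord_recr/= expRD mulrC ler_wpM2r//.
  by rewrite expw (le_trans (ler_norm _))// le_supnorm.
pose C := n.+1%:R^-1 * \sum_(r < n.+1) a r * (W * a (n.+1 - r)%N).
(* As [C] does not depend on [k], the growth rate cannot be positive. *)
have bound k : iter_norm (Aphi A psi) (k.+1 * n.+1) <= C.
  have [x <-] := iter_norm_max hcompact hne ca hP (k.+1 * n.+1).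
  rewrite (iter_Aphi _ ca hA)//.
  have hM := transfer_iter (k.+1 * n.+1) ca hA.
  have cQr r : cfun (fun x => Q k.+1 (iter r alpha x)).
    by apply: cfun_comp => //; exact: continuous_iter.
  apply: (@le_trans _ _ (iter (k.+1 * n.+1) A (fun x => n.+1%:R^-1 *
      \sum_(r < n.+1) Q k.+1 (iter r alpha x)) x)).
    apply: (transfer_le hM).
    - by apply: cfunM => //; apply: cfun_expR; exact: cfun_birkhoff.
    - by apply: cfunM; [exact: cfun_cst|exact: cfun_sum].
    move=> z; rewrite mulr1 birkhoffM.
    apply: le_trans (expR_mean _); rewrite ler_expR mulr_sumr.
    apply: ler_sum => r _; rewrite /birkhoff -mulr_sumr.
    by [].
  rewrite (transferZ _ hM); last exact: cfun_sum.
  rewrite ler_wpM2l// (transfer_sum _ hM)//; apply: ler_sum => r _.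
  have rn : (r <= n.+1)%N by exact: ltnW.
  (* The first [r] iterates remove [alpha^r], the next [k * n.+1] absorb [Q k] by [AQ], and the last
     [n.+1 - r] are bounded by their norm. *)
  have -> : (k.+1 * n.+1 = (n.+1 - r + k * n.+1) + r)%N.
    by rewrite mulSn addnAC subnK.
  rewrite iterD.
  have [_ _ _ Ar4] := transfer_iter r ca hA.
  have -> : iter r A (fun x => Q k.+1 (iter r alpha x)) =
      (fun x => Q k.+1 x * iter r A (@Defs.one_fun R X) x).
    rewrite -Ar4//; congr (iter _ _ _).
    by apply/funext => z; rewrite mulr1.
  have hM' := transfer_iter (n.+1 - r + k * n.+1) ca hA.
  apply: (@le_trans _ _ (iter (n.+1 - r + k * n.+1) A
      (fun x => (a r * W) * Q k x) x)).
    apply: (transfer_le hM').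
    - apply: cfunM => //; exact: (cfun_iter1 ca hA).
    - by apply: cfunM => //; exact: cfun_cst.
    move=> z; rewrite -mulrA mulrC; apply: ler_pM => //.
    - exact: (iter1_ge0 ca hA).
    - exact: (iter1_le hcompact hne ca hA).
  rewrite (transferZ _ hM')// mulrA ler_wpM2l ?mulr_ge0//.
  rewrite iterD -[leRHS]mul1r.
  apply: (iter_le_norm hcompact hne ca hA) => //.
  exact: (cfun_iter ca hA).
pose k := Num.truncn (C / (y * n.+1%:R)).
exists (k.+1 * n.+1).-1; rewrite prednK ?muln_gt0//.
apply: (le_trans (bound k)).
have yn0 : 0 < y * n.+1%:R by rewrite mulr_gt0.
have : C <= y * (k.+1 * n.+1)%:R.
  rewrite natrM mulrCA -ler_pdivrMr// ltW//; exact: truncnS_gt.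
by move=> h; apply: (le_trans h); have := expR_ge1Dx (y * (k.+1 * n.+1)%:R); lra.
Qed.

(* [w] is, up to normalisation, the density [\sum_i mu(D i) / v i * D i] given
   by the first-order condition for a state maximising the sum in [tau_nD];
   [eps] makes it positive. *)
Lemma tau_nD_ge n mu k (D : 'I_k -> X -> R) d : is_state mu -> is_pou D ->
  (forall w, cfun w -> (forall x, 0 < w x) ->
     (forall x, iter n A w x <= 1) -> mu (fun x => ln (w x)) <= - d) ->
  (d%:E <= tau_nD A n mu D)%E.
Proof.
move=> mus pouD hw; have mup := state_posfun mus.
pose p i := mu (D i).
have [p0 p1] : (forall i, 0 <= p i) /\ \sum_i p i = 1.
  exact: state_pou_weights.
have [_ cD D0 D1] := pouD.
have hT := transfer_iter n ca hA.
pose a := iter_norm A n.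
have a0 : 0 <= a by exact: (iter_norm_ge0 hcompact hne ca hA).
have Lp m : is_state m -> posfun (fun f => m (iter n A f)).
  exact: (state_iter_posfun ca hA).
have v0 m i : is_state m -> 0 <= m (iter n A (D i)).
  by move=> ms; apply: (Lp m ms).2.
have sumv m : is_state m -> \sum_i m (iter n A (D i)) <= a.
  move=> ms; rewrite -(posfun_sum (Lp m ms))//; under eq_fun do rewrite D1.
  apply: state_le => //; first exact: (cfun_iter1 ca hA).
  exact: (iter1_le hcompact hne ca hA).
have va m i : is_state m -> m (iter n A (D i)) <= a.
  move=> ms; apply: le_trans (sumv m ms); rewrite (bigD1 i)//= lerDl.
  by apply: sumr_ge0 => j _; exact: v0.
(* A lower bound [b] for the shifted coordinates of positive weight, fixed before [eps] is chosen:
   the full sum is at least [d - (1 + a)], and all terms but one add up to at most [a + k]. *)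
pose c0 := d - (1 + a) - (a + k%:R).
pose b_ i := if 0 < p i then p i * expR (c0 / p i) else 1.
have [b b0 bb] : exists2 b, 0 < b & forall i, b <= b_ i.
  apply: finite_pos_lb => i; rewrite /b_; case: ifP => // pi.
  by rewrite mulr_gt0 ?expR_gt0.
apply/lee_subgt0Pr => e e0.
have B0 : 0 < 1 + a + 2 / b by rewrite ltr_wpDr ?divr_ge0 ?(ltW b0)//; lra.
pose eps := Num.min 1 (Num.min (b / 2) (e / (1 + a + 2 / b))).
have eps0 : 0 < eps by rewrite !lt_min ltr01 !divr_gt0.
have eps1 : eps <= 1 by rewrite /eps ge_min lexx.
have epsb : eps <= b / 2 by rewrite /eps !ge_min lexx orbT.
have epse : eps * (1 + a + 2 / b) <= e.
  by rewrite -ler_pdivlMr// /eps !ge_min lexx !orbT.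
(* [K] contains the vectors of all point evaluations, so the optimality condition over [K] becomes a
   pointwise bound on [iter n A w]. *)
pose K := [set v | exists2 m, is_state m &
  v = (fun i => m (iter n A (D i)))].
have [x0 _] := hne.
have [||||_ [m ms ->] mmax] := @near_maximizer R k p K a eps p0 p1.
- by exists (fun i => iter n A (D i) x0), (fun f => f x0) => //; exact: eval_state.
- by move=> _ [m ms ->] i; rewrite v0//= va.
- move=> _ _ t [m1 ms1 ->] [m2 ms2 ->] t01.
  exists (fun f => (1 - t) * m1 f + t * m2 f) => //; exact: state_convex.
- by rewrite eps0.
pose v i := m (iter n A (D i)).
have ve i : 0 < v i + eps by rewrite ltr_wpDl// v0.
pose c i := p i / (v i + eps) + eps.
have c_gt0 i : 0 < c i by rewrite ltr_wpDl// divr_ge0 ?p0 ?(ltW (ve i)).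
(* [s] compensates the error [eps] of the optimality condition and the contribution [eps * a] of the
   shift in [c]. *)
pose s := 1 + eps * (1 + a).
have s1 : 1 <= s by rewrite lerDl mulr_ge0 ?(ltW eps0)//; lra.
have s0 : 0 < s by lra.
have lns : ln s <= eps * (1 + a).
  by have := ln_le_subr1 s0; rewrite /s; lra.
pose w x := s^-1 * \sum_i c i * D i x.
have sum0 x : 0 < \sum_i c i * D i x.
  apply: (@lt_le_trans _ _ (\sum_i eps * D i x)).
    by rewrite -mulr_sumr D1 mulr1.
  apply: ler_sum => i _; rewrite ler_wpM2r// lerDr.
  by rewrite divr_ge0 ?p0 ?(ltW (ve i)).
have ccD i : cfun (fun x => c i * D i x) by apply: cfunM => //; exact: cfun_cst.
have cw : cfun w by apply: cfunM; [exact: cfun_cst|exact: cfun_sum].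
have w0 x : 0 < w x by rewrite mulr_gt0 ?invr_gt0.
have Tw x : iter n A w x <= 1.
  rewrite (transferZ _ hT); last exact: cfun_sum.
  rewrite (transfer_sum _ hT)// ler_pdivrMl// mulr1.
  have -> : \sum_i iter n A (fun x => c i * D i x) x =
      \sum_i p i * (iter n A (D i) x / (v i + eps)) +
      eps * \sum_i iter n A (D i) x.
    rewrite mulr_sumr -big_split/=; apply: eq_bigr => i _.
    by rewrite (transferZ _ hT)// /c; ring.
  have h1 : \sum_i p i * (iter n A (D i) x / (v i + eps)) <= 1 + eps.
    by apply: mmax; exists (fun f => f x) => //; exact: eval_state.
  have h2 : \sum_i iter n A (D i) x <= a by exact: (sumv _ (@eval_state R X x)).
  have := ler_wpM2l (ltW eps0) h2; rewrite /s; lra.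
have lnw : \sum_i p i * ln (c i) - ln s <= - d.
  apply: le_trans (hw w cw w0 Tw).
  have <- : mu (fun x => \sum_i ln (c i) * D i x - ln s) =
      \sum_i p i * ln (c i) - ln s.
    have cl i : cfun (fun x => ln (c i) * D i x).
      by apply: cfunM => //; exact: cfun_cst.
    rewrite (posfunB mup); [|exact: cfun_sum|exact: cfun_cst].
    rewrite state_cst// (posfun_sum mup)//; congr (_ - _).
    by apply: eq_bigr => i _; rewrite (posfunZ mup)// mulrC.
  (* Concavity of [ln] at each point [x], with weights [D i x]. *)
  apply: (posfun_le mup).
  - apply: cfunB; last exact: cfun_cst.
    by apply: cfun_sum => i; apply: cfunM => //; exact: cfun_cst.
  - exact: cfun_ln.
  move=> x; rewrite /w lnM ?posrE ?invr_gt0// lnV ?posrE// addrC lerD2l.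
  under eq_bigr do rewrite mulrC.
  under [in leRHS]eq_bigr do rewrite mulrC.
  exact: (@sum_ln_le R k (fun i => D i x)).
have cq i : - (p i * ln (c i)) <= p i * ln ((v i + eps) / p i).
  have := p0 i; rewrite le_eqVlt => /predU1P[<-|pi]; first by rewrite !mul0r oppr0.
  rewrite -mulrN ler_pM2l// -lnV ?posrE// ler_ln ?posrE ?invr_gt0 ?divr_gt0//.
  rewrite -[leRHS]invrK lef_pV2 ?posrE ?invr_gt0 ?divr_gt0// invf_div.
  by rewrite lerDl ltW.
have sumq : d - eps * (1 + a) <= \sum_i p i * ln ((v i + eps) / p i).
  have : - (\sum_i p i * ln (c i)) <= \sum_i p i * ln ((v i + eps) / p i).
    by rewrite -sumrN; exact: ler_sum.
  lra.
have qle i : p i * ln ((v i + eps) / p i) <= v i + eps.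
  have := p0 i; rewrite le_eqVlt => /predU1P[<-|pi].
    by rewrite mul0r ltW.
  have := @ln_le_subr1 R ((v i + eps) / p i); rewrite divr_gt0// => /(_ isT) h.
  apply: (@le_trans _ _ (p i * ((v i + eps) / p i))).
    by rewrite ler_pM2l//; lra.
  by rewrite mulrC divfK// gt_eqF.
(* Each term is bounded above by [qle] and the sum below by [sumq], so no single term can be very
   negative. *)
have vb i : 0 < p i -> b / 2 <= v i.
  move=> pi; have := bb i; rewrite /b_ pi => bi.
  suff : p i * expR (c0 / p i) <= v i + eps by lra.
  rewrite mulrC -ler_pdivlMr// -[leRHS]lnK ?posrE ?divr_gt0// ler_expR.
  rewrite ler_pdivrMr// mulrC.
  have : \sum_(j | j != i) p j * ln ((v j + eps) / p j) <= a + k%:R.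
    apply: (@le_trans _ _ (\sum_j (v j + eps))).
      rewrite [leRHS](bigD1 i)//= ler_wpDl ?(ltW (ve i))//.
      by apply: ler_sum => j _; exact: qle.
    rewrite big_split/= sumr_const card_ord lerD ?sumv//.
    by rewrite -[eps *+ k]mulr_natl ler_piMr.
  move: sumq; rewrite (bigD1 i)//= /c0.
  have : eps * (1 + a) <= 1 + a by rewrite ler_piMl//; lra.
  lra.
have vn0 i : p i != 0 -> v i != 0.
  by move=> pi; rewrite gt_eqF// (lt_le_trans _ (vb _ _)) ?divr_gt0// lt_def pi p0.
apply: (@le_trans _ _ (\sum_i tau_term A n mu m (D i))%E); last first.
  by apply: ereal_sup_ubound; exists m.
rewrite (eq_bigr (fun i => (p i * ln (v i / p i))%:E)); last first.
  by move=> i _; apply: tau_term_fin; [exact: p0|exact: v0|exact: vn0].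
rewrite sumEFin -EFinB lee_fin.
(* Removing the shift costs [ln (1 + eps / v i) <= eps * (2 / b)], by the lower bound on [v i]. *)
have : \sum_i p i * ln ((v i + eps) / p i) <=
    \sum_i (p i * ln (v i / p i) + p i * (eps * (2 / b))).
  apply: ler_sum => i _; rewrite -mulrDr.
  have := p0 i; rewrite le_eqVlt => /predU1P[<-|pi]; first by rewrite !mul0r.
  have vbi := vb i pi; have vi0 : 0 < v i by lra.
  rewrite ler_pM2l// !ln_div ?posrE// addrAC lerD2r.
  have -> : v i + eps = v i * (1 + eps / v i).
    by rewrite mulrDr mulr1 mulrC divfK// gt_eqF.
  have ev0 : 0 < eps / v i by rewrite divr_gt0.
  rewrite lnM ?posrE//; last by lra.
  rewrite lerD2l (@le_trans _ _ (eps / v i))//.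
    by apply: le_ln1Dx; lra.
  rewrite ler_pM2l// -[leRHS]invrK lef_pV2 ?posrE ?invr_gt0 ?divr_gt0//.
  by rewrite invf_div.
rewrite big_split/= -mulr_suml p1 mul1r => h.
have : eps * (1 + a) + eps * (2 / b) <= e by rewrite -mulrDr.
lra.
Qed.

End LowerBound.

(** * The variational principle, by cases on the value of the limit *)

Theorem theorem1p17 (R : realType) (X : topologicalType)
  (hcompact : compact [set: X]) (hhaus : hausdorff_space X)
  (hne : [set: X] !=set0)
  (alpha : X -> X) (halpha : continuous alpha)
  (A : (X -> R) -> (X -> R)) (hA : is_transfer_operator alpha A)
  (phi : X -> R) (hphi : cfun phi) :
  exists l : \bar R,
    lambda_seq A phi @ \oo --> l /\
    (exists2 mu, is_inv_state alpha mu & (tau A mu + (mu phi)%:E)%E = l) /\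
    (forall mu, is_inv_state alpha mu -> (tau A mu + (mu phi)%:E <= l)%E).
Proof.
have hB := transfer_Aphi hphi hA.
have an0 := iter_norm_ge0 hcompact hne halpha hB.
have aM := iter_norm_submult hcompact hne halpha hB.
set a := iter_norm (Aphi A phi) in an0 aM.
exists (ereal_inf (range (growth a))).
have ub mu : is_inv_state alpha mu ->
    (tau A mu + (mu phi)%:E <= ereal_inf (range (growth a)))%E.
  move=> muinv; apply: le_ereal_inf_tmp => _ [n _ <-].
  exact: (tau_le_growth hcompact hne halpha hA).
split; first exact: fekete.
split => //.
case E : (ereal_inf (range (growth a))) => [l||].
- have hl n : expR (l * n.+1%:R) <= a n.+1.
    by apply: growth_ge => //; rewrite -E; apply: ereal_inf_lbound; exists n.
  have [mu muinv hmu] := equilibrium_state hcompact hne halpha hA hphi hl.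
  exists mu => //; apply/le_anti/andP; split; first by rewrite -E ub.
  rewrite -leeBlDr//; apply: le_ereal_inf_tmp => _ [n _ <-].
  rewrite lee_pdivlMl//; apply: le_ereal_inf_tmp => _ [k [D [pouD ->]]].
  have [mus _] := muinv; have mup := state_posfun mus.
  rewrite -EFinB -EFinM.
  apply: (tau_nD_ge hcompact hne halpha hA mus pouD) => w cw w0 Aw.
  have clw := cfun_ln cw w0.
  pose psi x := n.+1%:R^-1 * ln (w x).
  have cpsi : cfun psi by apply: cfunM => //; exact: cfun_cst.
  have : mu psi - mu phi <= - l.
    (* The growth rate of [A_psi] is below every [y > 0], so the subgradient inequality gives
       [mu psi - mu phi <= y - l]. *)
    apply/ler_addgt0Pr => y y0.
    have [m hm] := log_average_growth hcompact hne halpha hA cw w0 Aw y0.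
    by rewrite [leRHS]addrC; exact: (hmu _ _ _ cpsi hm).
  rewrite (posfunZ mup)// lerBlDr ler_pdivrMl// => h.
  by apply: (le_trans h); rewrite -mulrN opprB addrC.
(* The value [+oo] is excluded, as the first term is already bounded by a real number. *)
- have h : (growth a 0 <= (a 1%N)%:E)%E.
    by rewrite growth_le// mulr1; have := expR_ge1Dx (a 1%N); lra.
  suff : (+oo <= (a 1%N)%:E)%E by [].
  by apply: le_trans h; rewrite -E; apply: ereal_inf_lbound; exists 0%N.
(* At [-oo] any invariant state attains the maximum, by the upper bound; one arises from averaging a
   point evaluation. *)
- have [mu muinv _] := averaged_limit hcompact hne halpha
    (fun=> @eval_state R X (projT1 (cid hne))).
  exists mu => //; apply/eqP; rewrite -leeNy_eq -E; exact: ub.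
Qed.
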